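(* Let $\mathbf{b} = (b_0 \leq b_1 \leq b_2 \leq \cdots)$ be a nondecreasing sequence of nonnegative integers (the barrier). Fix a number $p \in (0,1)$ and let $q := 1-p$. For each $n \geq 0$ and each nondecreasing integer sequence $\mathbf{a} = (a_0 \leq a_1 \leq \cdots \leq a_n)$ with $0 \leq a_0$ and $a_j \leq b_j$ for all $0 \leq j \leq n$ (so $\mathbf{a}$ has length $\ell(\mathbf{a}) = n+1$), define the weight $$w(\mathbf{a}) := \frac{p^{n+1} q^{b_{n+1} + 1}}{1 - q^{1+b_0}} \, .$$ Then $$\sum_{\mathbf{a}} w(\mathbf{a}) \leq 1,$$ where the sum is over all finite such sequences, that is, over all $k > 0$ and all such $\mathbf{a}$ lying below the barrier with $\ell(\mathbf{a}) = k$. Furthermore, let $\theta := \liminf_{n\to\infty} b_n / n \in [0,\infty]$. Then whether equality holds in the inequality $\sum_{\mathbf{a}} w(\mathbf{a}) \leq 1$ is determined as follows: (i) if $\theta < q/p$ then equality holds; (ii) if $\theta = q/p$ then equality holds provided $|b_n - \theta n| = O(\sqrt{n})$; (iii) if $\theta > q/p$ then equality fails.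
   Context: The barrier $\mathbf{b}$ is a fixed nondecreasing sequence of nonnegative integers $b_0 \leq b_1 \leq \cdots$. The sequences $\mathbf{a}$ summed over are exactly the nondecreasing integer sequences $0 \leq a_0 \leq \cdots \leq a_n$ with $a_j \leq b_j$ for $0 \leq j \leq n$, for all $n \geq 0$. *)

(* Defs.v *)
From mathcomp Require Import all_boot all_order all_algebra.
From mathcomp Require Import all_classical all_reals all_analysis.

Set Implicit Arguments.
Unset Strict Implicit.
Unset Printing Implicit Defensive.

Import Order.TTheory GRing.Theory Num.Theory.

Local Open Scope classical_set_scope.
Local Open Scope ring_scope.

(* A sequence a_0 <= ... <= a_n of nonnegative integers is a nonempty list
   of naturals, with length l(a) = n + 1 = size a. *)
Definition below_barrier (b : nat -> nat) : set (seq nat) :=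
  [set a : seq nat | [/\ (0 < size a)%N, sorted leq a &
     forall j : nat, (j < size a)%N -> (nth 0%N a j <= b j)%N]].

(* Since size a = n + 1, this is p^(n+1) q^(b_(n+1) + 1) / (1 - q^(1 + b_0))
   with q = 1 - p. *)
Definition weight (R : realType) (p : R) (b : nat -> nat) (a : seq nat) : R :=
  let q := 1 - p in
  p ^+ size a * q ^+ (b (size a) + 1) / (1 - q ^+ (1 + b 0%N)).

Local Open Scope ereal_scope.

Definition total_weight (R : realType) (p : R) (b : nat -> nat) : \bar R :=
  \esum_(a in below_barrier b) (weight p b a)%:E.

(* The term n = 0 is 0 by the convention x / 0 = 0; it does not affect the
   limit inferior. *)
Definition barrier_slope (R : realType) (b : nat -> nat) : \bar R :=
  limn_einf (fun n : nat => ((b n)%:R / n%:R : R)%:E).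

(* Main.v *)
Require Import Defs.
From mathcomp Require Import all_boot all_order all_algebra.
From mathcomp Require Import all_classical all_reals all_analysis.
From mathcomp Require Import ring lra zify.

Set Implicit Arguments.
Unset Strict Implicit.
Unset Printing Implicit Defensive.

Import Order.TTheory GRing.Theory Num.Theory.
Import numFieldNormedType.Exports.

Local Open Scope classical_set_scope.
Local Open Scope ring_scope.

(* Consider the random lattice path from the origin that steps east with
   probability p and north with probability q = 1 - p. Up to the factor
   1 / (1 - q^(1 + b_0)), w(a) is the probability that the first east steps have
   heights a_0, ..., a_n and that the path then crosses the barrier before its
   next east step. The total weight is therefore the probability that the path
   ever crosses the barrier, given that it does not do so before its first east
   step, and it equals 1 iff the path almost surely crosses. Cases (i) and (iii)
   follow from optional stopping of an exponential supermartingale.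

   In case (ii), it suffices that from any point at or above the axis the path
   crosses before a later column with probability bounded below. Over the next m
   columns, let Z = exp(v Y) with Y the height above the line of slope q / p and
   v = lam / sqrt m. The combination - Z + a Z^(K+1) - c Z^(K+2) is bounded
   above, and negative when the path ends below the barrier for a suitable a;
   but for K and then lam large and c small its expectation is positive, since
   E Z^j is of order exp(const j^2 lam^2). *)

(** * Polynomial bounds on the exponential and on one step of the path *)

Section ExpBounds.
Variable R : realType.
Implicit Types x v : R.

Lemma expR_ge_deg2 x : 0 <= x -> 1 + x + x ^+ 2 / 2 <= expR x.
Proof.
move=> x_ge0; rewrite /expR; apply: limr_ge; first exact: is_cvg_series_exp_coeff.
exists 3 => // n /= n3; rewrite /series /= (big_cat_nat (n := 3)) //=.
rewrite !big_nat_recr //= big_geq // /exp_coeff /= add0r expr0 expr1 !divr1.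
by rewrite lerDl sumr_ge0 // => i _; rewrite divr_ge0 // exprn_ge0.
Qed.

Lemma expR_le_deg3 x : 0 <= x <= 1 -> expR x <= 1 + x + x ^+ 2 / 2 + x ^+ 3.
Proof.
move=> /andP[x_ge0 x_le1]; rewrite /expR.
apply: limr_le; first exact: is_cvg_series_exp_coeff.
exists 3 => // n /= n3; rewrite -(subnK n3).
(* The terms of degree at least 3 are dominated by a geometric series. *)
have le_geo (d : nat) : series (exp_coeff x) (d + 3)%N <=
    1 + x + x ^+ 2 / 2 + x ^+ 3 * (1 - (2 ^- d)).
  elim: d => [|d IH].
    rewrite /series /= !big_nat_recr //= big_geq // /exp_coeff /= add0r !expr0 expr1.
    by rewrite !divr1 invr1 subrr mulr0 addr0.
  rewrite addSn seriesSr.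
  have : exp_coeff x (d + 3) <= x ^+ 3 * 2 ^- d.+1.
    have fact_ge : (2 ^ d.+1 <= (d + 3)`!)%N.
      elim: {IH} d => // d IHd; rewrite addSn factS expnS; apply: leq_mul => //; lia.
    rewrite /exp_coeff /= exprD; apply: ler_pM => //.
    - by rewrite mulr_ge0 ?exprn_ge0.
    - by rewrite ler_piMl ?exprn_ge0 // exprn_ile1.
    - by rewrite lef_pV2 ?posrE ?exprn_gt0 ?ltr0n ?fact_gt0 // -natrX ler_nat.
  move: IH; rewrite (exprS 2 d) invfM; set A := series _ _; set B := exp_coeff _ _.
  by set y := x ^+ 3; set z := 2 ^- d => ? ?; lra.
by apply: le_trans (le_geo _) _; rewrite lerD2l ler_piMr ?exprn_ge0 // gerBl.
Qed.

Lemma expR_le_deg2 x : 0 <= x <= 1 / 2 -> expR x <= 1 + x + x ^+ 2.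
Proof.
move=> /andP[x_ge0 x_le]; apply: le_trans (expR_le_deg3 _) _.
  by apply/andP; split; lra.
rewrite exprS; nra.
Qed.

Lemma expRN_le_deg2 x : 0 <= x -> expR (- x) <= 1 - x + x ^+ 2.
Proof.
move=> x_ge0; rewrite expRN; apply: (@le_trans _ _ (1 + x)^-1).
  by rewrite lef_pV2 ?posrE ?expR_gt0 ?expR_ge1Dx //; lra.
rewrite -div1r ler_pdivrMr; last lra.
(* [(1 + x) * (1 - x + x ^+ 2) = 1 + x ^+ 3]. *)
have : 0 <= x ^+ 3 by rewrite exprn_ge0.
rewrite exprS; nra.
Qed.

(** At [t = 0] the left side is 1 with derivative [p * c - (1 - p) < 0], so a small [t] works. The
    choice of [K] keeps the second-order term below the first-order gain. *)
Lemma exists_exp_supermartingale (p c : R) : 0 < p < 1 -> 0 <= c -> p * c < 1 - p ->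
  exists2 t, 0 < t & p * expR (t * c) + (1 - p) * expR (- t) <= 1.
Proof.
move=> /andP[p_gt0 p_lt1] c_ge0 pc; pose K := 2 * (c + 1) ^+ 2.
have K_gt0 : 0 < K by rewrite mulr_gt0 // exprn_gt0 //; lra.
pose t := (1 - p - p * c) / K.
have tK : t * K = 1 - p - p * c by rewrite divfK // gt_eqF.
have t_gt0 : 0 < t by rewrite divr_gt0 //; lra.
exists t => //.
have pc_ge0 : 0 <= p * c by rewrite mulr_ge0 // ltW.
have t_le : t * (c + 1) ^+ 2 <= 1 / 2.
  by move: tK; rewrite /K mulrCA => ?; nra.
have tc_ge0 : 0 <= t * c by rewrite mulr_ge0 // ltW.
have tcc_ge0 : 0 <= t * c * c by rewrite mulr_ge0.
have tc_le : t * c <= 1 / 2 by move: t_le; rewrite sqrrD1; nra.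
have h1 : expR (t * c) <= 1 + t * c + (t * c) ^+ 2.
  by apply: expR_le_deg2; rewrite tc_ge0.
have h2 := expRN_le_deg2 (ltW t_gt0).
have : p * expR (t * c) <= p * (1 + t * c + (t * c) ^+ 2) by rewrite ler_pM2l.
have : (1 - p) * expR (- t) <= (1 - p) * (1 - t + t ^+ 2) by rewrite ler_pM2l //; lra.
have : t * (t * (p * c ^+ 2 + (1 - p))) <= t * (1 - p - p * c).
  rewrite ler_pM2l // -tK ler_pM2l // /K sqrrD1.
  have : 0 <= c ^+ 2 by rewrite exprn_ge0.
  by nra.
by nra.
Qed.

Lemma exists_exp_supermartingaleN (p c : R) : 0 < p < 1 -> 1 - p < p * c ->
  exists2 t, 0 < t & p * expR (- (t * c)) + (1 - p) * expR t <= 1.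
Proof.
move=> /andP[p_gt0 p_lt1] pc; pose K := 2 * (c + 1) ^+ 2.
have c_gt0 : 0 < c by rewrite -(pmulr_rgt0 _ p_gt0); lra.
have K_gt0 : 0 < K by rewrite mulr_gt0 // exprn_gt0 //; lra.
pose t := (p * c - (1 - p)) / K.
have tK : t * K = p * c - (1 - p) by rewrite divfK // gt_eqF.
have t_gt0 : 0 < t by rewrite divr_gt0 //; lra.
exists t => //.
have pcc : p * c <= c by rewrite ger_pMl // ltW.
have t_le : t <= 1 / 2.
  by rewrite ler_pdivrMr // /K sqrrD1; nra.
have h1 : expR t <= 1 + t + t ^+ 2 by apply: expR_le_deg2; rewrite ltW.
have tc_ge0 : 0 <= t * c by rewrite mulr_ge0 // ltW.
have h2 := expRN_le_deg2 tc_ge0.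
have : p * expR (- (t * c)) <= p * (1 - t * c + (t * c) ^+ 2) by rewrite ler_pM2l.
have : (1 - p) * expR t <= (1 - p) * (1 + t + t ^+ 2) by rewrite ler_pM2l //; lra.
have : t * (t * (p * c ^+ 2 + (1 - p))) <= t * (p * c - (1 - p)).
  rewrite ler_pM2l // -tK ler_pM2l // /K sqrrD1.
  have : 0 <= c ^+ 2 by rewrite exprn_ge0 // ltW.
  by nra.
by nra.
Qed.

(** The linear terms cancel, leaving [p - p * (1 - p) / 2 * v ^+ 2] up to third order; [v <= p / 4]
    absorbs the error. The middle term is the denominator of [exp_rate]. *)
Lemma exp_combination_bounds (p v : R) : 0 < p < 1 -> 0 <= v <= p / 4 ->
  p * expR (- (2 * (1 - p) / p * v ^+ 2)) <=
    expR ((1 - p) * v) - (1 - p) * expR v <=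
  p * expR (- ((1 - p) / 4 * v ^+ 2)).
Proof.
move=> /andP[p_gt0 p_lt1] /andP[v_ge0 v_le].
have q_gt0 : 0 < 1 - p by lra.
have qv_ge0 : 0 <= (1 - p) * v by rewrite mulr_ge0 // ltW.
have qv_le : (1 - p) * v <= v by rewrite ler_piMl //; lra.
have v2_ge0 : 0 <= v ^+ 2 by rewrite exprn_ge0.
have ev_le : expR v <= 1 + v + v ^+ 2 by apply: expR_le_deg2; rewrite v_ge0; lra.
have ev_ge := expR_ge_deg2 v_ge0.
have eqv_le : expR ((1 - p) * v) <=
    1 + (1 - p) * v + ((1 - p) * v) ^+ 2 / 2 + ((1 - p) * v) ^+ 3.
  by apply: expR_le_deg3; rewrite qv_ge0; lra.
have eqv_ge := expR_ge1Dx ((1 - p) * v).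
apply/andP; split.
- pose u := (1 - p) / p * v ^+ 2.
  have -> : 2 * (1 - p) / p * v ^+ 2 = 2 * u by rewrite /u; ring.
  have u_ge0 : 0 <= u by rewrite !mulr_ge0 ?invr_ge0 // ltW.
  have pu : p * u = (1 - p) * v ^+ 2 by rewrite /u; field; rewrite gt_eqF.
  have u_le : u <= 1 / 4 by rewrite -(ler_pM2l p_gt0) pu; nra.
  have e2u : expR (- (2 * u)) <= 1 - 2 * u + (2 * u) ^+ 2.
    by apply: expRN_le_deg2; rewrite mulr_ge0.
  have e2u' : expR (- (2 * u)) <= 1 - u by apply: le_trans e2u _; nra.
  have : p * expR (- (2 * u)) <= p * (1 - u) by rewrite ler_pM2l.
  have : (1 - p) * expR v <= (1 - p) * (1 + v + v ^+ 2) by rewrite ler_pM2l.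
  by rewrite mulrBr pu mulr1; lra.
- have : p * (1 - (1 - p) / 4 * v ^+ 2) <= p * expR (- ((1 - p) / 4 * v ^+ 2)).
    by rewrite ler_pM2l // expR_ge1Dx.
  have : (1 - p) * (1 + v + v ^+ 2 / 2) <= (1 - p) * expR v by rewrite ler_pM2l.
  have v3 : (1 - p) ^+ 3 * v ^+ 3 <= (1 - p) * (p / 4) * v ^+ 2.
    rewrite !exprS !expr0 !mulr1 -!mulrA ler_pM2l //.
    have : (1 - p) * ((1 - p) * (v * v)) * v <= 1 * (v * v) * (p / 4).
      apply: ler_pM => //; last by rewrite mul1r; nra.
      by rewrite !mulr_ge0 // ltW.
    lra.
  by move: eqv_le; rewrite !exprMn; move: v3; rewrite !expr2; lra.
Qed.
End ExpBounds.

(** * Enumeration of the sequences below the barrier *)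

Fixpoint ladders (b : nat -> nat) (T n x : nat) : seq (seq nat) :=
  if T is T'.+1 then
    [seq y :: a | y <- index_iota x (b n).+1, a <- ladders b T' n.+1 y]
  else [:: [::]].

Lemma mem_ladders (b : nat -> nat) (T n x : nat) (a : seq nat) :
  (a \in ladders b T n x) <->
  [/\ size a = T, path leq x a &
      forall j, (j < size a)%N -> (nth 0%N a j <= b (n + j))%N].
Proof.
elim: T n x a => [|T IH] n x a /=.
  rewrite inE; split=> [/eqP ->|[/size0nil -> _ _]] //.
split=> [/allpairsPdep[y [a' [yI a'I ->]]]|].
  move: yI a'I; rewrite mem_index_iota ltnS => /andP[xy yb] /IH[sa pa ba] /=.
  split; rewrite ?sa ?xy // => -[|j] /=; first by rewrite addn0.
  by rewrite ltnS -sa addnS -addSn => /ba.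
case: a => [[]|y a] //= [[sa] /andP[xy pa] ba].
apply/allpairsPdep; exists y, a; split=> //.
  by rewrite mem_index_iota xy ltnS; have := ba 0%N isT; rewrite addn0.
apply/IH; split=> // j ja; have := ba j.+1; rewrite /= ltnS addSn -addnS.
exact.
Qed.

Lemma uniq_ladders (b : nat -> nat) (T n x : nat) : uniq (ladders b T n x).
Proof.
elim: T n x => [|T IH] n x //=.
apply: allpairs_uniq_dep => [|y _|]; rewrite ?iota_uniq //.
by move=> [y a] [y' a'] /= _ _ [<- <-].
Qed.

Lemma size_laddersS (b : nat -> nat) (T n x : nat) :
  size (ladders b T.+1 n x) =
  (\sum_(x <= y < (b n).+1) size (ladders b T n.+1 y))%N.
Proof. by rewrite /= size_allpairs_dep sumnE big_map. Qed.

(** * Survival probabilities and the total weight *)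

Section Survival.
Variables (R : realType) (p : R) (b : nat -> nat).
Hypotheses (p_gt0 : 0 < p) (p_lt1 : p < 1).
Hypothesis b_nd : forall m n : nat, (m <= n)%N -> (b m <= b n)%N.
Let q := 1 - p.

Let q_gt0 : 0 < q. Proof. by rewrite subr_gt0. Qed.
Let q_lt1 : q < 1. Proof. by rewrite gtrBl. Qed.
Let pq1 : p + q = 1. Proof. by rewrite addrC subrK. Qed.
Let p_ge0 := ltW p_gt0.
Let q_ge0 := ltW q_gt0.

(* The probability that a random lattice path from (n, x), going east with
   probability p and north with probability q, makes T east steps with the
   i-th east step at a height at most b i. *)
Fixpoint survival (T n x : nat) : R :=
  if T is T'.+1 then
    \sum_(x <= y < (b n).+1) p * q ^+ (y - x) * survival T' n.+1 y
  else 1.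

Lemma survival_ge0 T n x : 0 <= survival T n x.
Proof.
elim: T n x => [|T IH] n x //=; apply: sumr_ge0 => y _.
by rewrite !mulr_ge0 ?IH ?exprn_ge0.
Qed.

Lemma survival_north T n x : (x <= b n)%N ->
  survival T.+1 n x = p * survival T n.+1 x + q * survival T.+1 n x.+1.
Proof.
move=> xb; rewrite /= big_ltn ?ltnS // subnn expr0 mulr1; congr (_ + _).
rewrite mulr_sumr big_seq_cond [RHS]big_seq_cond; apply: eq_bigr => y.
rewrite andbT mem_index_iota => /andP[xy _].
by rewrite -(subnSK xy) exprS; ring.
Qed.

(* Optional stopping along one run of north steps: such a run ends with an
   east step or by crossing the barrier. *)
Lemma subharmonic_run (phi : nat -> nat -> R) n x :
    (forall y, (y <= b n)%N ->
       phi n y <= p * phi n.+1 y + q * phi n y.+1) ->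
    (x <= (b n).+1)%N ->
  phi n x <= \sum_(x <= y < (b n).+1) p * q ^+ (y - x) * phi n.+1 y
             + q ^+ ((b n).+1 - x) * phi n (b n).+1.
Proof.
move=> sub; move: {2}(_ - x)%N (erefl ((b n).+1 - x)%N) => d.
elim: d x => [|d IH] x dE xb.
  have -> : x = (b n).+1 by lia.
  by rewrite big_geq // subnn mul1r add0r.
have xbn : (x <= b n)%N by lia.
apply: le_trans (sub _ xbn) _.
rewrite big_ltn ?ltnS // subnn expr0 mulr1 -addrA lerD2l.
have := IH x.+1 ltac:(lia) ltac:(lia).
rewrite -(ler_pM2l q_gt0) => /le_trans; apply.
rewrite mulrDr mulrA -exprS -subSn ?subSS // lerD2r mulr_sumr.
rewrite big_seq_cond [leRHS]big_seq_cond; apply: ler_sum => y.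
rewrite andbT mem_index_iota => /andP[xy _].
by rewrite -(subnSK xy) exprS !mulrA (mulrC q p).
Qed.

(** Optional stopping at the crossing or after [T] east steps: a crossing contributes at most 0 to
    the mean of [phi], survival at most [k]. A negative [k] turns this into an upper bound on
    [survival]. *)
Lemma subharmonic_le_survival (phi : nat -> nat -> R) (k : R) T n x :
    (forall i y, (n <= i < n + T)%N -> (y <= b i)%N ->
       phi i y <= p * phi i.+1 y + q * phi i y.+1) ->
    (forall i, (n <= i < n + T)%N -> phi i (b i).+1 <= 0) ->
    (forall y, (y <= b (n + T))%N -> phi (n + T)%N y <= k) ->
    (x <= b n)%N ->
  phi n x <= k * survival T n x.
Proof.
elim: T n x => [|T IH] n x sub bd term xb.
  by rewrite mulr1 -{1}(addn0 n) term ?addn0.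
apply: le_trans (@subharmonic_run phi n x _ (leqW xb)) _.
  by move=> y; apply: sub; lia.
rewrite -[leRHS]addr0 lerD //; last first.
  by rewrite mulr_ge0_le0 ?exprn_ge0 //; apply: bd; lia.
rewrite /= mulr_sumr big_seq_cond [leRHS]big_seq_cond; apply: ler_sum => y.
rewrite andbT mem_index_iota => /andP[xy yb].
rewrite [leRHS]mulrCA ler_pM2l ?mulr_gt0 ?exprn_gt0 //.
apply: IH => [i z ib|i ib|z|].
- by apply: sub; lia.
- by apply: bd; lia.
- by rewrite addSnnS; apply: term.
- by apply: leq_trans (b_nd (leqnSn n)).
Qed.

(** Markov property at the [k]-th east step. *)
Lemma survival_mul k m n x (c : R) :
    (forall y, (y <= b (n + k))%N -> survival m (n + k) y <= c) ->
    (x <= b n)%N ->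
  survival (k + m) n x <= c * survival k n x.
Proof.
elim: k n x => [|k IH] n x le_c xb.
  by rewrite mulr1 -{1}(addn0 n) le_c ?addn0.
rewrite addSn /= mulr_sumr big_seq_cond [leRHS]big_seq_cond.
apply: ler_sum => y; rewrite andbT mem_index_iota => /andP[xy yb].
rewrite [leRHS]mulrCA ler_pM2l ?mulr_gt0 ?exprn_gt0 //.
apply: IH => [z|]; first by rewrite addSnnS; apply: le_c.
by apply: leq_trans (b_nd (leqnSn n)).
Qed.

(** One way to survive is to begin with [k] east steps along the axis. *)
Lemma survival_east k m n : p ^+ k * survival m (n + k) 0 <= survival (k + m) n 0.
Proof.
elim: k n => [|k IH] n; first by rewrite addn0 mul1r.
rewrite addSn survival_north // addnS -addSn exprS -mulrA.
apply: ler_wpDr; last by rewrite ler_pM2l.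
by rewrite mulr_ge0 ?survival_ge0.
Qed.

(** The difference is the probability of crossing between the [T]-th east step and the next. Up to
    the crossing, such a path is determined by the heights of its east steps, and all these paths
    have equally many steps of each kind. *)
Lemma survival_escape T n x : (x <= b n)%N ->
  survival T n x - survival T.+1 n x =
  (size (ladders b T n x))%:R * p ^+ T * q ^+ ((b (n + T)).+1 - x).
Proof.
elim: T n x => [|T IH] n x xb.
  (* Constants are harmonic: the run inequality for 1 and for -1 gives an equality. *)
  have h1 := @subharmonic_run (fun _ _ => 1) n x.
  have h2 := @subharmonic_run (fun _ _ => -1) n x.
  rewrite /= mulr1 mul1r addn0; apply/eqP; rewrite subr_eq addrC eq_le.
  rewrite -[q ^+ _]mulr1 h1 ?(leqW xb) //=; last by move=> y _; rewrite !mulr1 pq1.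
  rewrite -lerN2 opprD -mulrN -sumrN.
  under eq_bigr do rewrite -mulrN.
  by rewrite h2 ?(leqW xb) // => y _; rewrite !mulrN1 -opprD pq1.
rewrite [survival T.+1]/= [survival T.+2 n x]/= -sumrB size_laddersS.
rewrite natr_sum !mulr_suml.
rewrite big_seq_cond [RHS]big_seq_cond; apply: eq_bigr => y.
rewrite andbT mem_index_iota => /andP[xy yb].
rewrite -mulrBr [X in _ * X]IH; last by apply: leq_trans (b_nd (leqnSn n)).
have bnT : (b n <= b (n.+1 + T))%N by apply: b_nd; lia.
rewrite addnS -addSn.
have -> : ((b (n.+1 + T)).+1 - x = (y - x) + ((b (n.+1 + T)).+1 - y))%N by lia.
by rewrite exprS exprD; ring.
Qed.

Lemma survival1 : survival 1 0 0 = 1 - q ^+ (b 0).+1.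
Proof.
have := @survival_escape 0 0 0 (leq0n _).
by rewrite [size _]/= !mul1r subn0 addn0 => <-; rewrite opprB addrCA subrr addr0.
Qed.

Lemma survival1_gt0 : 0 < survival 1 0 0.
Proof. by rewrite survival1 subr_gt0 exprn_ilt1 // ltW. Qed.

Lemma survival_noninc T : survival T.+1 0 0 <= survival T 0 0.
Proof.
by rewrite -subr_ge0 survival_escape // !mulr_ge0 ?exprn_ge0 ?ler0n.
Qed.

Lemma survival_le S T : (S <= T)%N -> survival T 0 0 <= survival S 0 0.
Proof.
by move=> ST; apply: (@nonincreasing_seqP _ _ (fun T => survival T 0 0)).1 => // n;
  exact: survival_noninc.
Qed.

Lemma below_barrierE :
  below_barrier b = \bigcup_(k in [set: nat]) [set` ladders b k.+1 0 0].
Proof.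
apply/seteqP; split=> a.
  case: a => [|y a] [//] _ sa ba; exists (size a) => //.
  by apply/mem_ladders; split.
move=> [k _] /mem_ladders[sa pa ba]; split=> //; first by rewrite sa.
by case: a pa {sa ba} => [|y a] //= /andP[].
Qed.

Let term_ge0 k : (0 <= ((survival k.+1 0 0 - survival k.+2 0 0) / survival 1 0 0)%:E)%E.
Proof.
by rewrite lee_fin divr_ge0 ?(ltW survival1_gt0) // subr_ge0 survival_noninc.
Qed.

(** Sequences of equal length have equal weight, so grouping by length and [survival_escape] give a
    telescoping series. *)
Lemma total_weightE : total_weight p b =
  (\sum_(k <oo)
    ((survival k.+1 0 0 - survival k.+2 0 0) / survival 1 0 0)%:E)%E.
Proof.
have w_ge0 (a : seq nat) : (0 <= (weight p b a)%:E)%E.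
  by rewrite lee_fin /weight -/q addn1 add1n -survival1 divr_ge0 ?(ltW survival1_gt0)
    // mulr_ge0 ?exprn_ge0.
rewrite /total_weight below_barrierE esum_bigcupT //; last first.
  move=> i j _ _ [a [/mem_ladders[si _ _] /mem_ladders[sj _ _]]].
  by apply: succn_inj; rewrite -si -sj.
rewrite nneseries_esumT //.
apply: eq_esum => k _; rewrite esum_fset //; last exact: finite_seq.
rewrite -fsbig_seq ?uniq_ladders // sumEFin; congr EFin.
rewrite survival_escape // subn0 add0n -!mulrA [RHS]mulr_natl.
rewrite (eq_big_seq (fun=> p ^+ k.+1 * (q ^+ (b k.+1).+1 / survival 1 0 0))).
  by rewrite big_const_seq count_predT iter_addr_0.
by move=> a /mem_ladders[sa _ _]; rewrite /weight -/q sa addn1 add1n -survival1 mulrA.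
Qed.

Let partial_sum n : (\sum_(0 <= k < n)
    ((survival k.+1 0 0 - survival k.+2 0 0) / survival 1 0 0)%:E
  = (1 - survival n.+1 0 0 / survival 1 0 0)%:E)%E.
Proof.
rewrite sumEFin -mulr_suml; congr EFin.
under eq_bigr do rewrite -opprB.
rewrite sumrN (telescope_sumr (fun k => survival k.+1 0 0)) // opprB mulrBl divff //.
exact: lt0r_neq0 survival1_gt0.
Qed.

Lemma total_weight_le (c : R) : (forall T, c <= survival T 0 0) ->
  (total_weight p b <= (1 - c / survival 1 0 0)%:E)%E.
Proof.
move=> le_c; rewrite total_weightE; apply: lime_le.
  by apply: is_cvg_nneseries.
near=> n; rewrite partial_sum lee_fin lerD2l lerN2 ler_pM2r ?le_c //.
by rewrite invr_gt0 survival1_gt0.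
Unshelve. all: by end_near. Qed.

Lemma total_weight_ge T :
  ((1 - survival T 0 0 / survival 1 0 0)%:E <= total_weight p b)%E.
Proof.
(* The partial sums start at [survival 1]; passing to [T.+1] covers [T = 0]. *)
apply: (@le_trans _ _ (1 - survival T.+1 0 0 / survival 1 0 0)%:E)%E; last first.
  by rewrite -partial_sum total_weightE; apply: nneseries_lim_ge.
rewrite lee_fin lerD2l lerN2 ler_pM2r ?survival_noninc //.
by rewrite invr_gt0 survival1_gt0.
Qed.

Lemma total_weight_le1 : (total_weight p b <= 1)%E.
Proof.
by have := @total_weight_le 0 (fun T => survival_ge0 T 0 0); rewrite mul0r subr0.
Qed.

Lemma total_weight_eq1 :
  (forall e, 0 < e -> exists T, survival T 0 0 <= e) -> total_weight p b = 1%E.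
Proof.
move=> small; apply/eqP; rewrite eq_le total_weight_le1 /=.
apply/lee_addgt0Pr => e e_gt0.
have [T leT] := small (e * survival 1 0 0) (mulr_gt0 e_gt0 survival1_gt0).
have := total_weight_ge T => /(leeD2r e%:E); apply: le_trans.
by rewrite -EFinD lee_fin addrAC lerBrDr lerD2l ler_pdivrMr // survival1_gt0.
Qed.

Lemma total_weight_neq1 (c : R) : 0 < c -> (forall T, c <= survival T 0 0) ->
  total_weight p b <> 1%E.
Proof.
move=> c_gt0 /total_weight_le /[swap] ->; rewrite lee_fin lerBrDr gerDl.
by rewrite leNgt divr_gt0 // survival1_gt0.
Qed.

End Survival.

(** * Barriers whose slope differs from [q / p] *)

Section Slopes.
Variables (R : realType) (p : R) (b : nat -> nat).
Hypotheses (p_gt0 : 0 < p) (p_lt1 : p < 1).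
Hypothesis b_nd : forall m n : nat, (m <= n)%N -> (b m <= b n)%N.
Let q := 1 - p.
Let q_gt0 : 0 < q. Proof. by rewrite subr_gt0. Qed.
Let p01 : 0 < p < 1. Proof. by rewrite p_gt0. Qed.

(** For [d] between [c] and [q / p], [expR (t * (d * i - y))] is a supermartingale starting at 1. On
    survival up to a column [n] with [b n <= c * n] it is at least [expR (t * (d - c) * n)], so
    survival decays exponentially along such [n]. *)
Lemma survival_small_of_low_slope (c : R) : 0 <= c -> p * c < q ->
    (forall N, exists2 n, (N <= n)%N & (b n)%:R <= c * n%:R) ->
  forall e, 0 < e -> exists T, survival p b T 0 0 <= e.
Proof.
move=> c_ge0 pc b_le e e_gt0.
have [d cd pd] : exists2 d, c < d & p * d < q.
  exists ((c + q / p) / 2).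
    have : c < q / p by rewrite ltr_pdivlMr // mulrC.
    by move=> ?; lra.
  have -> : p * ((c + q / p) / 2) = (p * c + q) / 2 by field; rewrite gt_eqF.
  by move: pc => ?; lra.
have [t t_gt0 t_super] := exists_exp_supermartingale p01 (le_trans c_ge0 (ltW cd)) pd.
have u_gt0 : 0 < t * (d - c) by rewrite mulr_gt0 // subr_gt0.
(* For [n >= x], [1 <= e * (t * (d - c) * n)]; this suffices since [1 + u <= expR u]. *)
pose x := (e * (t * (d - c)))^-1.
have x_ge0 : 0 <= x by rewrite invr_ge0 ltW // mulr_gt0.
have [n nN bn] := b_le (Num.bound x); exists n.
pose phi (i y : nat) : R := - expR (t * (d * i%:R - y%:R)).
have : phi 0%N 0%N <= - expR (t * (d - c) * n%:R) * survival p b n 0 0.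
  apply: subharmonic_le_survival => // [i y _ _|i _|y yb].
  - rewrite /phi -!natr1 !mulrN -opprD lerN2.
    set z := t * (d * i%:R - y%:R).
    have -> : t * (d * (i%:R + 1) - y%:R) = z + t * d by rewrite /z; ring.
    have -> : t * (d * i%:R - (y%:R + 1)) = z - t by rewrite /z; ring.
    rewrite !expRD.
    have : expR z * (p * expR (t * d) + (1 - p) * expR (- t)) <= expR z.
      by rewrite ger_pMr // expR_gt0.
    by move=> ?; lra.
  - by rewrite oppr_le0 expR_ge0.
  - rewrite lerN2 ler_expR -mulrA ler_pM2l // mulrBl lerD2l lerN2.
    by rewrite (le_trans _ bn) // ler_nat.
rewrite /phi mulr0 subrr mulr0 expR0 mulNr lerN2 => W1.
rewrite -(ler_pM2l (expR_gt0 (t * (d - c) * n%:R))); apply: le_trans W1 _.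
apply: le_trans (ler_wpM2r (ltW e_gt0) (expR_ge1Dx _)).
rewrite mulrDl mul1r; apply: ler_wpDl (ltW e_gt0) _.
have : x <= n%:R.
  by apply: le_trans (ltW (archi_boundP x_ge0)) _; rewrite ler_nat.
by rewrite /x -div1r ler_pdivrMr ?mulr_gt0 //; lra.
Qed.

(** From column [M] on, [1 - expR (t * (y - c * i))] is a submartingale, at most 0 on crossing and
    at most 1 otherwise, so its value at height 0 bounds survival from below. *)
Lemma survival_large_of_high_slope (c : R) (N : nat) : q < p * c ->
    (forall n, (N <= n)%N -> c * n%:R <= (b n)%:R) ->
  exists2 e, 0 < e & forall T, e <= survival p b T 0 0.
Proof.
move=> pc b_ge.
have c_gt0 : 0 < c by rewrite -(pmulr_rgt0 _ p_gt0) (lt_trans q_gt0).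
have [t t_gt0 t_super] := exists_exp_supermartingaleN p01 pc.
pose phi (i y : nat) : R := 1 - expR (t * (y%:R - c * i%:R)).
(* A nonzero column makes [phi M 0] positive. *)
pose M := N.+1.
exists (p ^+ M * phi M 0).
  rewrite mulr_gt0 ?exprn_gt0 // subr_gt0 expR_lt1 add0r mulrN oppr_lt0.
  by rewrite !mulr_gt0 // ltr0n.
move=> T; apply: le_trans (survival_le p_gt0 p_lt1 b_nd (leq_addl M T)).
apply: le_trans (@survival_east _ _ _ p_gt0 p_lt1 M T 0).
rewrite ler_pM2l ?exprn_gt0 // add0n -[leRHS]mul1r.
apply: subharmonic_le_survival => // [i y _ _|i iM|y _].
- rewrite /phi -!natr1.
  set z := t * (y%:R - c * i%:R).
  have -> : t * (y%:R - c * (i%:R + 1)) = z - t * c by rewrite /z; ring.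
  have -> : t * (y%:R + 1 - c * i%:R) = z + t by rewrite /z; ring.
  rewrite !expRD.
  have : expR z * (p * expR (- (t * c)) + (1 - p) * expR t) <= expR z.
    by rewrite ger_pMr // expR_gt0.
  by move=> ?; lra.
- rewrite subr_le0 -[leLHS]expR0 ler_expR mulr_ge0 ?(ltW t_gt0) // subr_ge0.
  by apply: le_trans (b_ge i _) _; [lia|rewrite ler_nat].
- by rewrite gerBl expR_ge0.
Qed.


(** * Barriers of critical slope *)

(* An east step changes y by - q and a north step by p, so that y has mean
   increment 0; d counts the east steps still to be made. *)
Definition exp_rate (v : R) : R := p / (expR (q * v) - q * expR v).
Definition exp_mart (v : R) (d : nat) (y : R) : R :=
  expR (v * y) * exp_rate v ^+ d.

Let alpha := 2 * q / p.
Let beta := q / 4.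
Let alpha_gt0 : 0 < alpha. Proof. by rewrite divr_gt0 // mulr_gt0. Qed.
Let beta_gt0 : 0 < beta. Proof. by rewrite divr_gt0. Qed.

Let exp_den_gt0 v : 0 <= v <= p / 4 -> 0 < expR (q * v) - q * expR v.
Proof.
move=> /(exp_combination_bounds p01)/andP[h _]; apply: lt_le_trans h.
by rewrite mulr_gt0 // expR_gt0.
Qed.

(** The martingale property: [exp_rate v] is the mean of the factor gained over one column, that is,
    a geometric number of north steps and the east step ending them. *)
Lemma exp_martE v d y : 0 <= v <= p / 4 ->
  exp_mart v d.+1 y = p * exp_mart v d (y - q) + q * exp_mart v d.+1 (y + p).
Proof.
move=> v_ok; have den_gt0 := exp_den_gt0 v_ok; rewrite /exp_mart exprS.
have -> : v * (y - q) = v * y - q * v by ring.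
have -> : v * (y + p) = v * y + (v - q * v) by rewrite /q; ring.
rewrite !expRD expRN.
have : expR (q * v) != 0 by rewrite gt_eqF // expR_gt0.
rewrite /exp_rate; move: (gt_eqF den_gt0).
set A := expR (q * v); set B := expR v; set r := (_ / _) ^+ d => /negbT h1 h2.
by field; rewrite h1 h2.
Qed.

Lemma exp_rate_bounds v : 0 <= v <= p / 4 ->
  expR (beta * v ^+ 2) <= exp_rate v <= expR (alpha * v ^+ 2).
Proof.
move=> v_ok; have den_gt0 := exp_den_gt0 v_ok.
have /andP[lo hi] := exp_combination_bounds p01 v_ok.
rewrite /exp_rate ler_pdivlMr // ler_pdivrMr //; apply/andP; split.
  by rewrite mulrC -ler_pdivlMr ?expR_gt0 // -expRN.
by rewrite [leRHS]mulrC -ler_pdivrMr ?expR_gt0 // -expRN.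
Qed.

Lemma exp_rate_ge1 v : 0 <= v <= p / 4 -> 1 <= exp_rate v.
Proof.
move=> v_ok; have /andP[h _] := exp_rate_bounds v_ok.
by apply: le_trans h; rewrite -[leLHS]expR0 ler_expR mulr_ge0 ?sqr_ge0 // ltW.
Qed.

Lemma exp_rate_pow_bounds v d : 0 <= v <= p / 4 ->
  expR (beta * (v ^+ 2 * d%:R)) <= exp_rate v ^+ d <= expR (alpha * (v ^+ 2 * d%:R)).
Proof.
move=> v_ok; have /andP[lo hi] := exp_rate_bounds v_ok.
have rate_ge0 := le_trans (expR_ge0 _) lo.
by rewrite (mulrA beta) (mulrA alpha) !expRM_natr; apply/andP; split; apply: lerXn2r;
  rewrite // nnegrE expR_ge0.
Qed.

(** Beyond [z = a / c] the left side is negative; before it, [a * z ^+ n] is at most its value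
    there. *)
Let monomial_peak (a c z : R) n : 0 < a -> 0 < c -> 0 <= z ->
  a * z ^+ n - c * z ^+ n.+1 <= a * (a / c) ^+ n.
Proof.
move=> a_gt0 c_gt0 z_ge0; have ac_ge0 : 0 <= a / c by rewrite ltW // divr_gt0.
have [z_le|z_gt] := leP z (a / c).
  apply: (@le_trans _ _ (a * z ^+ n)).
    by rewrite gerBl mulr_ge0 ?exprn_ge0 // ltW.
  by rewrite ler_pM2l // lerXn2r.
apply: (@le_trans _ _ 0); last by rewrite mulr_ge0 ?exprn_ge0 // ltW.
rewrite exprS mulrA -mulrBl mulr_le0_ge0 ?exprn_ge0 // subr_le0.
by rewrite mulrC -ler_pdivrMr // ltW.
Qed.

(** The function [phi] below is at most 0 on crossing, at most -1 on survival, and at least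
    [1 / 2 / B - 1] at the start. The bound [B] depends on [p] and [C] but not on the starting
    column. *)
Lemma survival_contraction (C : R) (N : nat) : 0 <= C ->
    (forall n, (N <= n)%N -> (b n)%:R <= q / p * n%:R + C * Num.sqrt n%:R) ->
  exists2 del, 0 < del &
    forall n, exists m, forall x, (x <= b n)%N -> survival p b m n x <= 1 - del.
Proof.
move=> C_ge0 b_le.
(* Survival to column [n0 + m], [m = r ^ 2], forces [y <= D * r]: [r] bounds [q * n0] and
   [2 * C * r] the square-root term. *)
pose D := 1 + 2 * C.
have D_gt0 : 0 < D by rewrite /D; lra.
(* With this [K], the mean of [Z ^+ K.+1] is at least [expR (2 * alpha * lam ^+ 2)], against at most
   [expR (alpha * lam ^+ 2)] for [Z]; [lam] makes this gap outweigh the factor [a]. *)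
pose K := Num.bound (2 * alpha / beta).
pose lam := 1 + (K%:R * D + 1) / alpha.
have KD_ge0 : 0 <= K%:R * D by rewrite mulr_ge0 // ltW.
have lam_ge1 : 1 <= lam.
  by rewrite lerDl divr_ge0 ?(ltW alpha_gt0) // addr_ge0.
have lam_gt0 : 0 < lam := lt_le_trans ltr01 lam_ge1.
have lam_large : K%:R * D * lam + 1 <= alpha * lam ^+ 2.
  have : alpha * lam = alpha + (K%:R * D + 1).
    by rewrite /lam mulrDr mulr1 mulrCA divff ?mulr1 // gt_eqF.
  move: (K%:R * D) KD_ge0 lam_ge1 alpha_gt0 => X X_ge0 l_ge1 al_gt0 e.
  by rewrite expr2 mulrA e; nra.
have K_large : 2 * alpha <= beta * K.+1%:R ^+ 2.
  have h : 2 * alpha / beta <= K.+1%:R.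
    apply: (@le_trans _ _ K%:R); last by rewrite ler_nat.
    apply/ltW/archi_boundP/divr_ge0; last exact: ltW.
    by apply: mulr_ge0; last exact: ltW.
  rewrite [leRHS]mulrC -ler_pdivrMr //; apply: le_trans h _.
  by rewrite expr2 ler_peMl // ler1n.
pose A2 := expR (alpha * (K.+1%:R ^+ 2 * lam ^+ 2)).
pose A3 := expR (alpha * (K.+2%:R ^+ 2 * lam ^+ 2)).
(* This [a] gives [a * Z ^+ K <= 1] whenever [y <= D * r]; [c] keeps the mean of [c * Z ^+ K.+2] at
   most 1/2. *)
pose a := expR (- (K%:R * D * lam)).
pose c := (2 * A3)^-1.
have a_gt0 : 0 < a by exact: expR_gt0.
have A2_gt0 : 0 < A2 by exact: expR_gt0.
have A3_gt0 : 0 < A3 by exact: expR_gt0.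
have c_gt0 : 0 < c by rewrite invr_gt0 mulr_gt0.
pose B := a * A2 * (a * A2 / c) ^+ K.+1.
have aA2_gt0 : 0 < a * A2 by apply: mulr_gt0.
have B_gt0 : 0 < B by rewrite mulr_gt0 // exprn_gt0 // divr_gt0.
exists (1 / 2 / B); first by rewrite divr_gt0.
move=> n0.
(* Large enough to pass [N] and [n0] and to keep all exponents [j * v], [j <= K.+2], in the range of
   the bounds on [exp_rate]. *)
pose r := (N + n0 + Num.bound (K.+2%:R * lam / (p / 4))).+1.
have r_gt0 : 0 < r%:R :> R by rewrite ltr0n.
pose v := lam / r%:R.
have v_gt0 : 0 < v by rewrite divr_gt0.
have vr : v * r%:R = lam by rewrite divfK // gt_eqF.
have v_ok j : (j <= K.+2)%N -> 0 <= j%:R * v <= p / 4.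
  move=> jK; apply/andP; split; first by rewrite mulr_ge0 // ltW.
  apply: (@le_trans _ _ (K.+2%:R * v)); first by rewrite ler_pM2r // ler_nat.
  rewrite /v mulrA ler_pdivrMr // [leRHS]mulrC -ler_pdivrMr ?divr_gt0 //.
  apply: (@le_trans _ _ (Num.bound (K.+2%:R * lam / (p / 4)))%:R).
    by apply/ltW/archi_boundP; rewrite !divr_ge0 ?mulr_ge0 ?(ltW lam_gt0) ?(ltW p_gt0).
  by rewrite ler_nat /r leqW // leq_addl.
clearbody v.
have Nr : (N <= r)%N by rewrite /r leqW // -addnA leq_addr.
have n0r : (n0 <= r)%N by rewrite /r leqW // addnAC leq_addl.
clearbody r.
pose m := (r ^ 2)%N.
have rm : (r <= m)%N by rewrite -{1}(expn1 r) leq_pexp2l // -(ltr0n R).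
have v2d (j d : nat) : (j%:R * v) ^+ 2 * d%:R = j%:R ^+ 2 * (v ^+ 2 * d%:R).
  by rewrite exprMn mulrA.
have v2m : v ^+ 2 * m%:R = lam ^+ 2 by rewrite natrX -exprMn vr.
have rate_le j d : (j <= K.+2)%N -> (d <= m)%N ->
    exp_rate (j%:R * v) ^+ d <= expR (alpha * (j%:R ^+ 2 * lam ^+ 2)).
  move=> jK dm; have /andP[_ h] := exp_rate_pow_bounds d (v_ok j jK).
  apply: le_trans h _; rewrite ler_expR ler_pM2l // v2d -v2m.
  by rewrite ler_wpM2l ?sqr_ge0 // ler_wpM2l ?sqr_ge0 // ler_nat.
pose f d y := - exp_mart (1%:R * v) d y + a * exp_mart (K.+1%:R * v) d y
              - c * exp_mart (K.+2%:R * v) d y.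
(* Drop the first term, bound the rates by [A2] in the second and by 1 from below in the third, then
   apply [monomial_peak]. *)
have f_le_B d y : (d <= m)%N -> f d y <= B.
  move=> dm; rewrite /f /exp_mart -!mulrA !expRM_natl expr1.
  set z := expR (v * y); have z_ge0 : 0 <= z by exact: expR_ge0.
  have h1 : 0 <= z * exp_rate (1%:R * v) ^+ d.
    by rewrite mulr_ge0 // exprn_ge0 // (le_trans ler01) // exp_rate_ge1 // v_ok.
  have h2 : a * (z ^+ K.+1 * exp_rate (K.+1%:R * v) ^+ d) <= a * A2 * z ^+ K.+1.
    rewrite -mulrA ler_pM2l // [leRHS]mulrC ler_wpM2l ?exprn_ge0 //.
    exact: rate_le.
  have h3 : c * z ^+ K.+2 <= c * (z ^+ K.+2 * exp_rate (K.+2%:R * v) ^+ d).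
    rewrite ler_pM2l // ler_peMr ?exprn_ge0 // exprn_ege1 // exp_rate_ge1 //.
    exact: v_ok.
  have := @monomial_peak (a * A2) c z K.+1 (mulr_gt0 a_gt0 A2_gt0) c_gt0 z_ge0.
  by rewrite -/B => ?; lra.
exists m => x x_le.
(* The last argument of [f] is [p] times the height above the line of slope [q / p] through the
   starting point. *)
pose phi (i z : nat) : R :=
  f (n0 + m - i)%N (p * (z%:R - x%:R) - q * (i%:R - n0%:R)) / B - 1.
suff : phi n0 x <= -1 * survival p b m n0 x.
  have f_start : 1 / 2 <= f m 0.
    rewrite /f /exp_mart !mulr0 expR0.
    have h1 := rate_le 1%N m isT (leqnn _); rewrite expr1n mul1r in h1.
    have h3 : c * exp_rate (K.+2%:R * v) ^+ m <= 1 / 2.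
      rewrite /c invfM -mulrA -[leRHS]mulr1 mul1r ler_pM2l // mulrC.
      by rewrite ler_pdivrMr // mul1r rate_le.
    have h2 : 2 * expR (alpha * lam ^+ 2) <= a * exp_rate (K.+1%:R * v) ^+ m.
      have /andP[lo _] := exp_rate_pow_bounds m (v_ok K.+1 (leqnSn _)).
      apply: (@le_trans _ _ (a * expR (beta * (K.+1%:R ^+ 2 * lam ^+ 2)))); last first.
        by rewrite ler_pM2l // -v2m -v2d.
      rewrite -expRD; apply: (@le_trans _ _ (expR (1 + alpha * lam ^+ 2))).
        rewrite expRD ler_pM2r ?expR_gt0 //.
        by have := expR_ge1Dx (1 : R) => ?; lra.
      rewrite ler_expR mulrA.
      have : 2 * alpha * lam ^+ 2 <= beta * K.+1%:R ^+ 2 * lam ^+ 2.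
        by rewrite ler_pM2r // exprn_gt0.
      by move: lam_large => ? ?; lra.
    have al_ge := expR_ge1Dx (alpha * lam ^+ 2).
    have : 0 <= alpha * lam ^+ 2 by rewrite mulr_ge0 ?sqr_ge0 // ltW.
    by move=> ?; lra.
  rewrite /phi addKn !subrr !mulr0 subrr mulN1r.
  have : 1 / 2 / B <= f m 0 / B by rewrite ler_pM2r // invr_gt0.
  by move=> ? ?; lra.
apply: subharmonic_le_survival => // [i z im _|i /andP[im _]|z z_le].
- rewrite /phi -!natr1.
  rewrite -(@subnSK i); last by case/andP: im.
  set d := (n0 + m - i.+1)%N; set y := p * (z%:R - x%:R) - q * (i%:R - n0%:R).
  have -> : p * (z%:R - x%:R) - q * (i%:R + 1 - n0%:R) = y - q by rewrite /y; ring.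
  have -> : p * (z%:R + 1 - x%:R) - q * (i%:R - n0%:R) = y + p by rewrite /y; ring.
  have -> : f d.+1 y = p * f d (y - q) + q * f d.+1 (y + p).
    rewrite /f !(@exp_martE _ d y) ?v_ok //; ring.
  by rewrite /q; lra.
- by rewrite subr_le0 ler_pdivrMr // mul1r f_le_B // leq_subLR leq_add2r.
- rewrite /phi subnn natrD [n0%:R + _]addrC addrK.
  rewrite -[leRHS]add0r lerD2r pmulr_lle0 ?invr_gt0 //.
  set y := p * _ - _.
  rewrite /f /exp_mart !expr0 !mulr1 -!mulrA !expRM_natl expr1.
  set t := expR (v * y); have t_gt0 : 0 < t by exact: expR_gt0.
  (* With no columns left, [f] is [t * (a * t ^+ K - 1) - c * t ^+ K.+2]. *)
  suff tK : a * t ^+ K <= 1.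
    have : t * (a * t ^+ K) <= t * 1 by rewrite ler_pM2l.
    have : 0 <= c * t ^+ K.+2 by rewrite mulr_ge0 ?exprn_ge0 // ltW.
    by rewrite (mulrCA t) -exprS mulr1 => ? ?; lra.
  rewrite /a /t -expRM_natl -expRD -[leRHS]expR0 ler_expR addrC subr_le0.
  rewrite -mulrA ler_wpM2l // -vr mulrCA ler_pM2l //.
  have zb : z%:R <= q / p * (n0 + m)%:R + C * (2 * r%:R).
    apply: (@le_trans _ _ (b (n0 + m))%:R); first by rewrite ler_nat.
    apply: le_trans (b_le _ _) _; first exact: leq_trans (leq_trans Nr rm) (leq_addl _ _).
    rewrite lerD2l ler_wpM2l // -[leRHS]ger0_norm ?mulr_ge0 // -sqrtr_sqr ler_sqrt.
      have : n0%:R <= m%:R :> R by rewrite ler_nat (leq_trans n0r).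
      have -> : (2 * r%:R) ^+ 2 = 4 * m%:R :> R by rewrite natrX; ring.
      by rewrite natrD; have : 0 <= m%:R :> R by []; lra.
    by rewrite sqr_ge0.
  have : p * z%:R <= p * (q / p * (n0 + m)%:R + C * (2 * r%:R)) by rewrite ler_pM2l.
  rewrite mulrDr !mulrA [p * q]mulrC mulfK ?gt_eqF // natrD.
  have pC : p * C * 2 * r%:R <= 2 * C * r%:R.
    by rewrite ler_pM2r // mulrC ler_pM2l // ler_piMl // ltW.
  have qn : q * n0%:R <= r%:R.
    apply: (@le_trans _ _ (1 * n0%:R)); last by rewrite mul1r ler_nat.
    by rewrite ler_wpM2r // gerBl ltW.
  have px : 0 <= p * x%:R by rewrite mulr_ge0 // ltW.
  by rewrite /y /D => ?; lra.
Qed.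

(** By the Markov property the infimum [s] of the survival probabilities satisfies
    [s <= (1 - del) * s], so [s] is 0. *)
Lemma survival_small_of_contraction (del : R) : 0 < del ->
    (forall n, exists m, forall x, (x <= b n)%N -> survival p b m n x <= 1 - del) ->
  forall e, 0 < e -> exists T, survival p b T 0 0 <= e.
Proof.
move=> del_gt0 contr e e_gt0.
pose S := [set survival p b T 0 0 | T in [set: nat]].
have lbS : lbound S 0 by move=> _ [T _ <-]; exact: survival_ge0.
have S0 : S !=set0 by exists (survival p b 0 0 0), 0%N.
have infS : has_inf S by split=> //; exists 0.
have inf_le T : inf S <= (1 - del) * survival p b T 0 0.
  have [m le_m] := contr T; apply: (@le_trans _ _ (survival p b (T + m) 0 0)).
    by apply: ge_inf; [exists 0|exists (T + m)%N].
  by apply: survival_mul => // y; rewrite add0n; apply: le_m.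
have inf_le0 : inf S <= 0.
  rewrite leNgt; apply/negP => inf_gt0.
  have del_lt1 : 0 < 1 - del.
    by apply: lt_le_trans inf_gt0 _; have := inf_le 0%N; rewrite mulr1.
  have : inf S / (1 - del) <= inf S.
    apply: lb_le_inf => // _ [T _ <-].
    by rewrite ler_pdivrMr // mulrC inf_le.
  rewrite ler_pdivrMr // mulrBr mulr1 => ?.
  have : 0 < inf S * del by rewrite mulr_gt0.
  by move=> ?; lra.
have [_ [T _ <-] W_lt] := inf_adherent e_gt0 infS.
by exists T; move: W_lt; lra.
Qed.

End Slopes.

(** * Frequent and eventual bounds from the limit inferior *)

Lemma limn_einf_sup_einfs (R : realType) (u : (\bar R)^nat) :
  limn_einf u = ereal_sup (range (einfs u)).
Proof. by rewrite limn_einf_lim; apply/cvg_lim => //; exact: cvg_einfs_sup. Qed.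

Lemma limn_einf_lt_frequently (R : realType) (u : (\bar R)^nat) (x : \bar R) :
  (limn_einf u < x)%E -> forall N, exists2 n, (N <= n)%N & (u n < x)%E.
Proof.
rewrite limn_einf_sup_einfs => lt_x N.
have : (einfs u N < x)%E.
  by apply: le_lt_trans lt_x; apply: ereal_sup_ubound; exists N.
by move=> /ereal_inf_lt[_ [n /= Nn <-] un]; exists n.
Qed.

Lemma limn_einf_gt_eventually (R : realType) (u : (\bar R)^nat) (x : \bar R) :
  (x < limn_einf u)%E -> exists N, forall n, (N <= n)%N -> (x < u n)%E.
Proof.
rewrite limn_einf_sup_einfs => /ereal_sup_gt[_ [N _ <-] xN]; exists N => n Nn.
by apply: lt_le_trans xN _; apply: ereal_inf_lbound; exists n.
Qed.

(** * The trichotomy by barrier slope *)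

Theorem theorem3 (R : realType) (p : R) (hp0 : 0 < p) (hp1 : p < 1)
    (b : nat -> nat) (hb : forall m n : nat, (m <= n)%N -> (b m <= b n)%N) :
  let q := 1 - p in
  let theta : \bar R := barrier_slope R b in
  [/\ (total_weight p b <= 1)%E,
      (theta < (q / p)%:E)%E -> total_weight p b = 1%E,
      theta = (q / p)%:E ->
        (fun n : nat => `|(b n)%:R - fine theta * n%:R|)
          =O_\oo (fun n : nat => Num.sqrt (n%:R : R)) ->
        total_weight p b = 1%E
    & ((q / p)%:E < theta)%E -> total_weight p b <> 1%E].
Proof.
move=> q theta; have q_gt0 : 0 < q by rewrite subr_gt0.
have qp_gt0 : 0 < q / p by rewrite divr_gt0.
split.
- exact: total_weight_le1.
- move=> theta_lt; apply: total_weight_eq1 => //.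
  have [c theta_c c_lt] : exists2 c, (theta < c%:E)%E & c < q / p.
    case: theta theta_lt => [r| |] //; last by exists 0 => //; exact: ltNyr.
    rewrite lte_fin => r_lt; exists ((r + q / p) / 2); first by rewrite lte_fin midf_lt.
    by rewrite midf_lt.
  (* The maximum with 0 supplies a nonnegative slope still below [q / p]. *)
  apply: (@survival_small_of_low_slope _ _ _ hp0 hp1 hb (Num.max 0 c)).
  + by rewrite le_max lexx.
  + by rewrite mulrC -ltr_pdivlMr // gt_max qp_gt0.
  (* Starting at [N.+1] avoids [n = 0], where the quotient is 0 by convention. *)
  + move=> N; have [n Nn] := limn_einf_lt_frequently theta_c N.+1.
    have n_gt0 : 0 < n%:R :> R by rewrite ltr0n (leq_trans _ Nn).
    rewrite lte_fin ltr_pdivrMr // => bn; exists n; first exact: ltnW.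
    by apply: le_trans (ltW bn) _; rewrite ler_pM2r // le_max lexx orbT.
- move=> -> /= /eqO_exP[C C_gt0 [N _ b_le]].
  apply: total_weight_eq1 => //.
  have [|del del_gt0 contr] :=
    @survival_contraction _ p b hp0 hp1 hb C N (ltW C_gt0).
    move=> n Nn; have := b_le n Nn; rewrite /= normr_id (ger0_norm (sqrtr_ge0 _)).
    by rewrite -lerBlDl; apply: le_trans; exact: ler_norm.
  exact: survival_small_of_contraction contr.
- move=> theta_gt.
  have [c c_gt theta_c] : exists2 c, q / p < c & (c%:E < theta)%E.
    case: theta theta_gt => [r| |] //; last first.
      by exists (q / p + 1); rewrite ?ltrDl // ltry.
    rewrite lte_fin => r_gt; exists ((q / p + r) / 2); first by rewrite midf_lt.
    by rewrite lte_fin midf_lt.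
  have [N b_gt] := limn_einf_gt_eventually theta_c.
  have [|n Nn|e e_gt0 e_le] :=
    @survival_large_of_high_slope _ p b hp0 hp1 hb c N.+1.
  + by rewrite mulrC -ltr_pdivrMr.
  + have n_gt0 : 0 < n%:R :> R by rewrite ltr0n (leq_trans _ Nn).
    have := b_gt n (ltnW Nn).
    by rewrite lte_fin ltr_pdivlMr // => /ltW.
  + exact: total_weight_neq1 e_le.
Qed.
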